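(* Let $f:\mathbb{R}\to\mathbb{R}$ be a $C^2$ function. The surfaces of revolution $\Sigma=\{(a,\rho):a=f(\rho)\}$ in the affine-additive group $\mathcal{AA}$ that have constant horizontal Gaussian curvature $K^h_\Sigma=k$ are the following: (1) the two parameter family of surfaces defined by $$f(\rho)=\frac12\left(\pm\sqrt{c\rho^2+c-1}\mp\arctan\left(\sqrt{c\rho^2+c-1}\right)+\arctan(\rho)\right)+C,\qquad c>0,\ C\in\mathbb{R},\ \rho^2>\frac1c-1,$$ if $k=0$; (2) the two parameter family of surfaces defined by $$f(\rho)=\frac12\left(\pm\arctan\left(\sqrt{\frac{\rho^2+c}{1-c}}\right)+\arctan(\rho)\right)+C,\qquad c\in(0,1),\ C\in\mathbb{R},$$ as well as the one parameter family defined by $$f(\rho)=\frac12\arctan(\rho)+C,\qquad C\in\mathbb{R},$$ if $k=-4$; (3) the two parameter family defined by $$f(\rho)=\frac12\arctan(\rho)\mp\frac12\arctan(w)\pm\begin{cases}\dfrac{\sqrt{c_1}}{2}\arctan\left(\dfrac{w}{\sqrt{c_1}}\right)+C, & c_1>0,\\[2mm] \dfrac{c_1}{4\sqrt{-c_1}}\ln\left|\dfrac{w-\sqrt{-c_1}}{w+\sqrt{-c_1}}\right|+C, & c_1<0,\end{cases}$$ where $C\in\mathbb{R}$, $c_1=\frac{k+4}{k}$, $$w=\sqrt{\frac{\left(1+\frac k4\right)\rho^2+1-c}{c-\frac k4\rho^2}}$$ and $c\in\mathbb{R}$ satisfies $$c-\frac k4\rho^2>0,\qquad\left(1+\frac k4\right)\rho^2>c-1,\qquad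 c\neq-\frac k4,$$ if $k\neq0$. In the particular case where $c=-k/4\neq0$ we have $$f(\rho)=\pm\frac14\sqrt{-c_1}\,\ln(\rho^2+1)+\frac12\arctan\rho+C,$$ for $\rho\neq0$.
   Context: The affine-additive group $\mathcal{AA}$ is $\{(a,\lambda,t):a\in\mathbb{R},\lambda>0,t\in\mathbb{R}\}$ with group law $(a,\lambda,t)\cdot(a',\lambda',t')=(a+a',\lambda\lambda',\lambda t'+t)$. Its left-invariant frame is $V=2\lambda\,\partial_\lambda$, $U=\partial_a+2\lambda\,\partial_t$, $W=-\partial_a$, with $[V,U]=2(U+W)$ the only non-vanishing bracket; the contact form is $\vartheta=\frac{dt}{2\lambda}-da$, the horizontal distribution is spanned by the orthonormal fields $V,U$, and $W$ is the Reeb field. For a surface $\Sigma=\{u=0\}$ with $C^2$ defining function $u$, put $\|\nabla_Hu\|=\sqrt{(Vu)^2+(Uu)^2}$. At non-characteristic points (those where $\|\nabla_Hu\|\neq0$) put $\overline p=Vu/\|\nabla_Hu\|$, $\overline q=Uu/\|\nabla_Hu\|$, $E_1=-\overline qV+\overline pU$. The horizontal Gaussian curvature is $$K^h_\Sigma=2E_1\left(\frac{Wu}{\|\nabla_Hu\|}\right)-4\left(\frac{Wu}{\|\nabla_Hu\|}\right)^2.$$ The surfaces of revolution considered here are the graphs $u=a-f(\rho)=0$ with $\rho=t/\lambda$ (invariant under $(a,\lambda,t)\mapsto(a,\delta\lambda,\delta t)$, $\delta>0$); their characteristic points are the points with $\rho=0$ and $f'(0)=\frac12$.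
   Formalization: For k=-4 the printed list omits solutions such as f constant; the formula of (2) is also allowed for c≤0 on ρ²>-c. Signs and C are fixed on each connected component of the domain (f=ρ/2, k=0 needs this), and f may be C² on any open interval. *)

(* Defs.v *)
From Stdlib Require Import Reals.
From Coquelicot Require Import Coquelicot.
Open Scope R_scope.

(* Functions on the affine-additive group are written in the coordinates
   (a, l, t).  They are total on R^3, but are only ever evaluated at points
   with l > 0, which form an open set. *)
Definition AAfun := R -> R -> R -> R.

Definition V (u : AAfun) : AAfun :=
  fun a l t => 2 * l * Derive (fun l' => u a l' t) l.

Definition U (u : AAfun) : AAfun :=
  fun a l t =>
    Derive (fun a' => u a' l t) a + 2 * l * Derive (fun t' => u a l t') t.

Definition W (u : AAfun) : AAfun :=
  fun a l t => - Derive (fun a' => u a' l t) a.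

Definition normH (u : AAfun) : AAfun :=
  fun a l t => sqrt ((V u a l t) ^ 2 + (U u a l t) ^ 2).

Definition noncharacteristic (u : AAfun) (a l t : R) : Prop :=
  normH u a l t <> 0.

Definition pbar (u : AAfun) : AAfun := fun a l t => V u a l t / normH u a l t.

Definition qbar (u : AAfun) : AAfun := fun a l t => U u a l t / normH u a l t.

Definition E1 (u h : AAfun) : AAfun :=
  fun a l t => - qbar u a l t * V h a l t + pbar u a l t * U h a l t.

Definition horizontal_gauss (u : AAfun) : AAfun :=
  fun a l t =>
    2 * E1 u (fun a' l' t' => W u a' l' t' / normH u a' l' t') a l t
    - 4 * (W u a l t / normH u a l t) ^ 2.

Definition revolution (f : R -> R) : AAfun := fun a l t => a - f (t / l).

(* The profile f is only meaningful on a domain D of values of rho = t / l. *)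
Definition constant_curvature (D : R -> Prop) (f : R -> R) (k : R) : Prop :=
  forall a l t : R,
    0 < l -> D (t / l) -> revolution f a l t = 0 ->
    noncharacteristic (revolution f) a l t ->
    horizontal_gauss (revolution f) a l t = k.

(* Used for open D only, where the two-sided notions at the points of D are
   the ones of f restricted to D. *)
Definition C2_on (D : R -> Prop) (f : R -> R) : Prop :=
  forall x : R, D x ->
    ex_derive f x /\ ex_derive (Derive f) x /\
    continuous (Derive (Derive f)) x.

Definition oitv (lo hi : Rbar) (x : R) : Prop := Rbar_lt lo x /\ Rbar_lt x hi.

Definition is_sign (s : R) : Prop := s = 1 \/ s = -1.

(* In the profiles below s = 1 or s = -1 selects the upper or the lower signs
   and C is the additive constant. *)

Definition profile_zero (c s C rho : R) : R :=
  1 / 2 * (s * sqrt (c * rho ^ 2 + c - 1)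
           - s * atan (sqrt (c * rho ^ 2 + c - 1)) + atan rho) + C.

Definition profile_m4 (c s C rho : R) : R :=
  1 / 2 * (s * atan (sqrt ((rho ^ 2 + c) / (1 - c))) + atan rho) + C.

Definition profile_atan (s C rho : R) : R := 1 / 2 * atan rho + C.

Definition c1 (k : R) : R := (k + 4) / k.

Definition w (k c rho : R) : R :=
  sqrt (((1 + k / 4) * rho ^ 2 + 1 - c) / (c - k / 4 * rho ^ 2)).

Definition profile_pos (k c s C rho : R) : R :=
  1 / 2 * atan rho - s * (1 / 2 * atan (w k c rho))
  + s * (sqrt (c1 k) / 2 * atan (w k c rho / sqrt (c1 k)) + C).

Definition profile_neg (k c s C rho : R) : R :=
  1 / 2 * atan rho - s * (1 / 2 * atan (w k c rho))
  + s * (c1 k / (4 * sqrt (- c1 k))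
         * ln (Rabs ((w k c rho - sqrt (- c1 k)) / (w k c rho + sqrt (- c1 k))))
         + C).

Definition profile_log (k s C rho : R) : R :=
  s * (1 / 4 * sqrt (- c1 k) * ln (rho ^ 2 + 1)) + 1 / 2 * atan rho + C.

Definition dom_w (k c rho : R) : Prop :=
  c - k / 4 * rho ^ 2 > 0 /\ (1 + k / 4) * rho ^ 2 > c - 1.

(* profile_family k Dom F: for fixed values of k and c, the profiles F s C, defined on
   Dom, form one of the families of curvature k. *)
Inductive profile_family (k : R) : (R -> Prop) -> (R -> R -> R -> R) -> Prop :=
| family_zero (c : R) :
    k = 0 -> c > 0 ->
    profile_family k (fun rho => rho ^ 2 > 1 / c - 1) (profile_zero c)
| family_m4 (c : R) :
    k = -4 -> 0 < c < 1 ->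
    profile_family k (fun _ => True) (profile_m4 c)
| family_m4_atan :
    k = -4 ->
    profile_family k (fun _ => True) profile_atan
(* The classification is false without this continuation of family_m4 to
   c <= 0: constant profiles (c = 0, with s the opposite of the sign of rho)
   have curvature -4 and belong to no other family.  No surface of this family
   has a characteristic point. *)
| family_m4_nonpos (c : R) :
    k = -4 -> c <= 0 ->
    profile_family k (fun rho => rho ^ 2 > - c) (profile_m4 c)
| family_pos (c : R) :
    k <> 0 -> c1 k > 0 -> c <> - k / 4 ->
    profile_family k (dom_w k c) (profile_pos k c)
| family_neg (c : R) :
    k <> 0 -> c1 k < 0 -> c <> - k / 4 ->
    profile_family k (dom_w k c) (profile_neg k c)
(* The case c = - k / 4; c1 k <= 0 makes the square root of - c1 k real. *)
| family_log :
    k <> 0 -> c1 k <= 0 ->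
    profile_family k (fun rho => rho <> 0) (profile_log k).

(* On I, f is a member of the family F with domain Dom: I is contained in Dom
   except possibly for the point rho = 0, and the sign and the additive
   constant are fixed on each connected component of the intersection of I
   and Dom.  They may differ on two components: rho / 2 has curvature 0 and is
   profile_zero 1 s 0, with s the sign of rho. *)
Definition member_on (I : R -> Prop) (f : R -> R)
    (Dom : R -> Prop) (F : R -> R -> R -> R) : Prop :=
  (forall x : R, I x -> x <> 0 -> Dom x) /\
  (forall lo hi : Rbar,
     (forall x : R, oitv lo hi x -> I x /\ Dom x) ->
     exists s C : R, is_sign s /\
       forall x : R, oitv lo hi x -> f x = F s C x).

(* Main.v *)
Require Import Defs.
From Stdlib Require Import Reals Lra.
From Coquelicot Require Import Coquelicot.
Open Scope R_scope.

(** Write [x] for [rho], [g = f'] and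
    [N2 = Vu^2 + Uu^2 = 4 x^2 g^2 + (1 - 2 g)^2] on the surface [a = f (t / l)].
    Since [Wu = -1], everything depends on [x] alone and
    [K = 2 x N2' / N2^2 - 4 / N2]; with [y = 1 / N2] the equation [K = k] reads
    [2 x y' + 4 y = - k], that is [(x^2 y + k/4 x^2)' = 0].  So
    [x^2 / N2 = c - k/4 x^2] for a constant [c].

    Completing the square in [g], put [G = 2 (1 + x^2) g - 1], so that
    [f' = (1 + G) / (2 (1 + x^2))] and [N2 = (G^2 + x^2) / (1 + x^2)].  The first
    integral becomes [G^2 = x^2 w^2] with
    [w^2 = ((1 + k/4) x^2 + 1 - c) / (c - k/4 x^2)], hence
    [f' = (1 + s x w) / (2 (1 + x^2))] with a sign [s].  The families of the
    theorem are the antiderivatives of these functions for the various [k] and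
    [c] ([profile_family_solution]); conversely each antiderivative has
    curvature [k] at its non-characteristic points ([solution_regular]).

    The classification has to deal with two degenerations.

    At [x = 0] the first integral is vacuous, so it must be shown that the
    constants [c] found for [x < 0] and [x > 0] agree ([first_integral]).
    If [G 0 <> 0] then [x^2 / N2] is continuous at [0] with value [0], and
    [c = 0] on both sides.  If [G 0 = 0], the quotient
    [H = G / x] extends continuously by [G' 0], and
    [x^2 / N2 = (1 + x^2) / (1 + H^2)] is continuous too.  In that case the
    extended [H] satisfies [H^2 = w^2], so the sign of [H] cannot change at [0]
    if [w 0 > 0]; if [w 0 = 0], then [0] is outside the domain of the family or
    [w] vanishes identically.

    The sign could also change at a zero [x <> 0] of [w].  But the numerator of [w^2] is a
    nonnegative polynomial [p x^2 + q] on an open set; a zero at some [x <> 0]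
    forces [p = q = 0] ([w_num_positive_or_degenerate]), i.e. [k = -4], [c = 1] and
    [f = atan / 2 + C]. *)

(** * The curvature of a surface of revolution *)

(** Both [u = a - f (t / l)] and [Wu / ||grad u||], which does not depend on [a],
    have the form [alpha a + phi (t / l)] near the point, so this one computation
    serves for the first derivatives of [u] and for those entering [K]. *)
Lemma frame_affine_revolution (alpha d : R) (phi : R -> R) (h : AAfun) (a l t : R) :
  0 < l -> is_derive phi (t / l) d ->
  locally (t / l) (fun r => forall a' l' t', 0 < l' -> t' / l' = r ->
                              h a' l' t' = alpha * a' + phi r) ->
  V h a l t = - 2 * (t / l) * d /\ U h a l t = alpha + 2 * d /\ W h a l t = - alpha.
Proof.
intros Hl Hphi Hh.
assert (Hex : ex_derive phi (t / l)) by now exists d.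
assert (Hd : Derive (fun x => phi x) (t / l) = d) by now apply is_derive_unique.
assert (Da : Derive (fun a' => h a' l t) a = alpha).
{ apply is_derive_unique.
  apply is_derive_ext with (fun a' => alpha * a' + phi (t / l)).
  - intros a'; symmetry; apply (locally_singleton _ _ Hh); auto.
  - auto_derive; auto; ring. }
assert (Dt : Derive (fun t' => h a l t') t = d / l).
{ apply is_derive_unique.
  apply is_derive_ext_loc with (fun t' => alpha * a + phi (t' / l)).
  - assert (Hc : continuous (fun t' => t' / l) t).
    { apply (ex_derive_continuous (fun t' => t' / l)); auto_derive; lra. }
    generalize (Hc _ Hh); unfold filtermap; apply filter_imp.
    intros t' Ht'; symmetry; auto.
  - auto_derive; [repeat split; auto; lra | unfold Rdiv in Hd; rewrite Hd; field; lra]. }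
assert (Dl : Derive (fun l' => h a l' t) l = - t / l ^ 2 * d).
{ apply is_derive_unique.
  apply is_derive_ext_loc with (fun l' => alpha * a + phi (t / l')).
  - assert (Hc : continuous (fun l' => t / l') l).
    { apply (ex_derive_continuous (fun l' => t / l')); auto_derive; lra. }
    specialize (Hc _ Hh); unfold filtermap in Hc.
    generalize (filter_and _ _ Hc (open_gt 0 l Hl)); apply filter_imp.
    intros l' [Hl1 Hl2]; symmetry; auto.
  - auto_derive; [repeat split; auto; lra | unfold Rdiv in Hd; rewrite Hd; field; lra]. }
unfold V, U, W; rewrite Da, Dt, Dl.
repeat split; field; lra.
Qed.

(** The squared length of the horizontal gradient of [a - f (t / l)]. *)
Definition norm2 (f : R -> R) (x : R) : R :=
  4 * x ^ 2 * (Derive f x) ^ 2 + (1 - 2 * Derive f x) ^ 2.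

Lemma norm2_ge0 (f : R -> R) (x : R) : 0 <= norm2 f x.
Proof.
unfold norm2.
assert (H1 := pow2_ge_0 (2 * x * Derive f x)).
assert (H2 := pow2_ge_0 (1 - 2 * Derive f x)).
lra.
Qed.

Lemma normH_revolution (f : R -> R) (a l t : R) :
  0 < l -> ex_derive f (t / l) ->
  V (revolution f) a l t = 2 * (t / l) * Derive f (t / l) /\
  U (revolution f) a l t = 1 - 2 * Derive f (t / l) /\
  W (revolution f) a l t = -1 /\
  normH (revolution f) a l t = sqrt (norm2 f (t / l)).
Proof.
intros Hl Hf.
destruct (frame_affine_revolution 1 (- Derive f (t / l)) (fun x => - f x)
            (revolution f) a l t) as [HV [HU HW]]; auto.
- now apply (is_derive_opp f), Derive_correct.
- apply filter_forall; intros r a' l' t' _ <-; unfold revolution; ring.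
- unfold normH; rewrite HV, HU, HW; repeat split; try lra.
  f_equal; unfold norm2; ring.
Qed.

(** Here [Wu / ||grad u|| = - 1 / sqrt N2], whose derivative in [x] is
    [N2' / (2 N2^(3/2))], and [E1 = 2 (pbar + x qbar) d/dx] on functions of [x],
    with [pbar + x qbar = x / sqrt N2]. *)
Lemma horizontal_gauss_revolution (f : R -> R) (a l t d : R) :
  0 < l -> locally (t / l) (ex_derive f) -> is_derive (norm2 f) (t / l) d ->
  norm2 f (t / l) <> 0 ->
  horizontal_gauss (revolution f) a l t
  = 2 * (t / l) * d / norm2 f (t / l) ^ 2 - 4 / norm2 f (t / l).
Proof.
intros Hl Hf Hd HN.
assert (Hpos : 0 < norm2 f (t / l)) by (destruct (norm2_ge0 f (t / l)); congruence).
assert (Hs := sqrt_lt_R0 _ Hpos).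
assert (Hs2 := sqrt_sqrt _ (Rlt_le _ _ Hpos)).
destruct (normH_revolution f a l t Hl (locally_singleton _ _ Hf)) as [HV [HU [HW HH]]].
set (s := sqrt (norm2 f (t / l))) in *.
destruct (frame_affine_revolution 0 (d / (2 * s ^ 3)) (fun x => - 1 / sqrt (norm2 f x))
   (fun a' l' t' => W (revolution f) a' l' t' / normH (revolution f) a' l' t') a l t)
  as [EV [EU _]]; auto.
- auto_derive.
  + repeat split; [now exists d | exact Hpos | fold s; lra].
  + fold s; replace (Derive (fun x : R => norm2 f x) (t / l)) with d
      by now symmetry; apply is_derive_unique.
    field; lra.
- generalize Hf; apply filter_imp; intros r Hr a' l' t' Hl' <-.
  destruct (normH_revolution f a' l' t' Hl' Hr) as [_ [_ [-> ->]]]; ring.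
- unfold horizontal_gauss, Defs.E1, qbar, pbar; rewrite EV, EU, HV, HU, HW, HH.
  rewrite <- Hs2; field; lra.
Qed.

(** * The integrated equation *)

(** [w_num] and [w_den] are the numerator and denominator under the root in [w]. *)
Definition w_num (k c x : R) : R := (1 + k / 4) * x ^ 2 + 1 - c.
Definition w_den (k c x : R) : R := c - k / 4 * x ^ 2.

(** The pair [k = -4], [c = 1] makes [w_num] vanish identically and [w = 0]
    smooth; elsewhere [w] is smooth only where it is positive. *)
Definition admissible (k c x : R) : Prop :=
  0 < w_den k c x /\ (0 < w_num k c x \/ (k = -4 /\ c = 1)).

(** The right-hand side of the integrated equation [f' = slope], with [s] the sign. *)
Definition slope (k c s x : R) : R := (1 + s * x * w k c x) / (2 * (1 + x ^ 2)).

Lemma sqr_pos (x : R) : 0 < 1 + x ^ 2.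
Proof. assert (H := pow2_ge_0 x); lra. Qed.

Lemma w_sqr (k c x : R) :
  admissible k c x -> w k c x ^ 2 = w_num k c x / w_den k c x.
Proof.
intros [Hd Hn]; unfold w; apply pow2_sqrt; fold (w_num k c x) (w_den k c x).
apply Rdiv_le_0_compat; [|exact Hd].
destruct Hn as [Hn|[-> ->]]; [lra|unfold w_num; lra].
Qed.

Lemma w_gt0 (k c x : R) : 0 < w_den k c x -> 0 < w_num k c x -> 0 < w k c x.
Proof.
intros Hd Hn; apply sqrt_lt_R0; now apply Rdiv_lt_0_compat.
Qed.

Lemma w_degenerate (x : R) : w (-4) 1 x = 0.
Proof.
unfold w; replace ((1 + -4 / 4) * x ^ 2 + 1 - 1) with 0 by field.
unfold Rdiv; rewrite Rmult_0_l; apply sqrt_0.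
Qed.

(** Solved for [c], the definition of [w] gives
    [c = (1 + x^2) / (1 + w^2) + k/4 x^2]: with [w] in place of [c] as parameter all
    derivatives become rational functions. *)
Lemma w_den_eq (k c x : R) :
  admissible k c x -> w_den k c x = (1 + x ^ 2) / (1 + w k c x ^ 2).
Proof.
intros Ha; rewrite (w_sqr k c x Ha); destruct Ha as [Hd _].
assert (Hx := sqr_pos x).
replace (1 + w_num k c x / w_den k c x) with ((1 + x ^ 2) / w_den k c x).
- field; lra.
- unfold w_num, w_den in *; field; lra.
Qed.

(** In the degenerate case [k = -4], [c = 1] both [c + k / 4] and [w] vanish;
    the value [0] of the quotient is then still the derivative of [w = 0]. *)
Definition w_deriv (k c x : R) : R := x * (c + k / 4) / (w_den k c x ^ 2 * w k c x).

Lemma is_derive_w (k c x : R) :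
  admissible k c x -> is_derive (w k c) x (w_deriv k c x).
Proof.
intros [Hd [Hn|[-> ->]]].
- assert (Hw := w_gt0 k c x Hd Hn).
  assert (Hq := Rdiv_lt_0_compat _ _ Hn Hd).
  assert (Hquot : is_derive (fun x => w_num k c x / w_den k c x) x
                    (2 * x * (c + k / 4) / w_den k c x ^ 2)).
  { unfold w_num, w_den in *; auto_derive; [lra|field; lra]. }
  evar_last.
  + exact (is_derive_sqrt _ _ _ Hquot Hq).
  + cbv beta; change (sqrt (w_num k c x / w_den k c x)) with (w k c x).
    unfold w_deriv; field; lra.
- apply (is_derive_ext (fun _ => 0)).
  + intros y; now rewrite w_degenerate.
  + replace (w_deriv (-4) 1 x) with 0.
    * apply (is_derive_const (V := R_NormedModule)).
    * unfold w_deriv; replace (1 + -4 / 4) with 0 by field; unfold Rdiv; ring.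
Qed.

Lemma continuous_w_deriv (k c x : R) :
  admissible k c x -> continuous (w_deriv k c) x.
Proof.
intros Ha; destruct (Ha) as [Hd [Hn|[-> ->]]].
- assert (Hw := w_gt0 k c x Hd Hn).
  apply (ex_derive_continuous (w_deriv k c)).
  unfold w_deriv, w_den in *; auto_derive.
  split; [exists (w_deriv k c x); now apply is_derive_w|split; [|auto]].
  repeat apply Rmult_integral_contrapositive_currified; simpl in Hd; lra.
- apply continuous_ext with (fun _ => 0); [|apply continuous_const].
  intros y; change (0 = w_deriv (-4) 1 y).
  unfold w_deriv; replace (1 + -4 / 4) with 0 by field; unfold Rdiv; ring.
Qed.

Definition slope_deriv (k c s x : R) : R :=
  (s * (w k c x + x * w_deriv k c x) * (1 + x ^ 2) - 2 * x * (1 + s * x * w k c x))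
  / (2 * (1 + x ^ 2) ^ 2).

Lemma is_derive_slope (k c s x : R) :
  admissible k c x -> is_derive (slope k c s) x (slope_deriv k c s x).
Proof.
intros Ha; assert (Hw := is_derive_w k c x Ha); assert (Hx := sqr_pos x).
unfold slope, slope_deriv; auto_derive.
- split; [now exists (w_deriv k c x)|split; [nra|auto]].
- replace (Derive (fun x => w k c x) x) with (w_deriv k c x)
    by now symmetry; apply is_derive_unique.
  field; lra.
Qed.

Lemma continuous_slope_deriv (k c s x : R) :
  admissible k c x -> continuous (slope_deriv k c s) x.
Proof.
intros Ha; assert (Hx := sqr_pos x).
assert (Cw : continuous (w k c) x).
{ apply (ex_derive_continuous (w k c)); exists (w_deriv k c x); now apply is_derive_w. }
assert (Cd := continuous_w_deriv k c x Ha).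
assert (Cp : forall p : R -> R, ex_derive p x -> continuous p x)
  by (intros p Hp; exact (ex_derive_continuous p x Hp)).
unfold slope_deriv, Rdiv, Rminus.
apply (continuous_mult (K := R_AbsRing)); [|apply Cp; auto_derive; nra].
apply (continuous_plus (V := R_NormedModule)).
- apply (continuous_mult (K := R_AbsRing)); [|apply Cp; auto_derive; auto].
  apply (continuous_mult (K := R_AbsRing)); [apply continuous_const|].
  apply (continuous_plus (V := R_NormedModule)); [exact Cw|].
  apply (continuous_mult (K := R_AbsRing)); [apply continuous_id|exact Cd].
- apply (continuous_opp (V := R_NormedModule)).
  apply (continuous_mult (K := R_AbsRing)); [apply Cp; auto_derive; auto|].
  apply (continuous_plus (V := R_NormedModule)); [apply continuous_const|].
  apply (continuous_mult (K := R_AbsRing)); [apply Cp; auto_derive; auto|exact Cw].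
Qed.

(** The first integral, read backwards. *)
Lemma norm2_slope (k c s x : R) (f : R -> R) :
  admissible k c x -> is_sign s -> Derive f x = slope k c s x ->
  norm2 f x = x ^ 2 / w_den k c x.
Proof.
intros Ha Hs Hf; assert (Hx := sqr_pos x).
unfold norm2; rewrite Hf, (w_den_eq k c x Ha).
assert (Hw := sqr_pos (w k c x)).
unfold slope; destruct Hs as [-> | ->]; field; lra.
Qed.

(** By [norm2_slope] the curvature formula is applied to [N2 = x^2 / w_den].  At
    [x = 0] this vanishes, so a point with [x = 0] is characteristic and only
    [x <> 0] remains to be considered. *)
Lemma solution_regular (k c s : R) (D : R -> Prop) (f : R -> R) :
  open D -> is_sign s ->
  (forall x, D x -> admissible k c x) ->
  (forall x, D x -> is_derive f x (slope k c s x)) ->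
  C2_on D f /\ constant_curvature D f k.
Proof.
intros HD Hs Ha Hf; split.
- intros x Dx.
  assert (L1 : locally x (fun y => slope k c s y = Derive f y)).
  { generalize (HD x Dx); apply filter_imp; intros y Dy.
    symmetry; now apply is_derive_unique, Hf. }
  assert (L2 : locally x (fun y => slope_deriv k c s y = Derive (Derive f) y)).
  { generalize (filter_and _ _ (HD x Dx) (locally_locally _ _ L1)).
    apply filter_imp; intros y [Dy Ly].
    symmetry; apply is_derive_unique.
    apply (is_derive_ext_loc (slope k c s)); [exact Ly|].
    now apply is_derive_slope, Ha. }
  repeat split.
  + exists (slope k c s x); auto.
  + exists (slope_deriv k c s x).
    apply (is_derive_ext_loc (slope k c s)); [exact L1|].
    now apply is_derive_slope, Ha.
  + apply continuous_ext_loc with (slope_deriv k c s); [exact L2|].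
    now apply continuous_slope_deriv, Ha.
- intros a l t Hl Dx _ Hnc.
  assert (Hex : locally (t / l) (ex_derive f)).
  { generalize (HD _ Dx); apply filter_imp; intros y Dy.
    exists (slope k c s y); auto. }
  unfold noncharacteristic in Hnc.
  destruct (normH_revolution f a l t Hl (locally_singleton _ _ Hex)) as [_ [_ [_ HH]]].
  rewrite HH in Hnc.
  set (x := t / l) in *.
  assert (HN : forall y, D y -> norm2 f y = y ^ 2 / w_den k c y).
  { intros y Dy; apply norm2_slope with s; auto; now apply is_derive_unique, Hf. }
  destruct (Ha x Dx) as [Hd _].
  assert (Hx : x <> 0).
  { intros H0; apply Hnc; rewrite (HN x Dx), H0; unfold Rdiv.
    replace (0 ^ 2 * _) with 0 by ring; apply sqrt_0. }
  assert (Hx2 : 0 < x ^ 2) by now apply pow2_gt_0.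
  assert (HdN : is_derive (norm2 f) x
                  ((2 * x * w_den k c x + x ^ 2 * (k / 2 * x)) / w_den k c x ^ 2)).
  { apply (is_derive_ext_loc (fun y => y ^ 2 / w_den k c y)).
    - generalize (HD x Dx); apply filter_imp; intros y Dy; symmetry; auto.
    - unfold w_den in *; auto_derive; [lra|field; lra]. }
  rewrite (horizontal_gauss_revolution f a l t _ Hl Hex HdN); fold x.
  + rewrite (HN x Dx); unfold w_den in *; field; lra.
  + rewrite (HN x Dx); apply Rgt_not_eq; now apply Rdiv_lt_0_compat.
Qed.

(** * The families as antiderivatives *)

(** What the proof uses about a family with parameters [k] and [c].  The shift
    property says that the additive constant may be anywhere in the formula; in
    some families it is multiplied by the sign. *)
Record solution_family (k c : R) (Dom : R -> Prop) (F : R -> R -> R -> R) : Prop := {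
  family_open : open Dom;
  family_admissible : forall x, Dom x -> admissible k c x;
  family_derive : forall s C x, is_sign s -> Dom x -> is_derive (F s C) x (slope k c s x);
  family_shift : forall s C d, is_sign s -> exists C', forall x, F s C x + d = F s C' x
}.

Lemma sign_sqr (s : R) : is_sign s -> s * s = 1.
Proof. intros [-> | ->]; ring. Qed.

Lemma open_quadratic (p q : R) : open (fun x => 0 < p * x ^ 2 + q).
Proof.
apply (open_comp (fun x => p * x ^ 2 + q) (fun y => 0 < y)).
- intros x _; apply (ex_derive_continuous (fun x => p * x ^ 2 + q)); auto_derive; auto.
- apply open_gt.
Qed.

(** [w_deriv] with [c] eliminated by [w_den_eq]. *)
Lemma w_deriv_w (k c x W : R) :
  admissible k c x -> w k c x = W -> W <> 0 ->
  w_deriv k c x = x * (1 + W ^ 2) * (1 + k / 4 * (1 + W ^ 2)) / ((1 + x ^ 2) * W).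
Proof.
intros Ha <- HW.
assert (Hx := sqr_pos x); assert (H1 := sqr_pos (w k c x)).
assert (Hden := w_den_eq k c x Ha).
assert (Hc : c = (1 + x ^ 2) / (1 + w k c x ^ 2) + k / 4 * x ^ 2)
  by (rewrite <- Hden; unfold w_den; ring).
unfold w_deriv; rewrite Hden.
replace (c + k / 4)
  with ((1 + x ^ 2) / (1 + w k c x ^ 2) + k / 4 * x ^ 2 + k / 4) by lra.
field; lra.
Qed.

(** The parameter of [profile_zero] is the inverse of the constant [c] of the
    first integral: for [k = 0] the denominator of [w^2] is constant, and
    [w^2 = (x^2 + 1 - c) / c]. *)
Lemma zero_family (c : R) :
  c > 0 -> solution_family 0 (/ c) (fun x => x ^ 2 > 1 / c - 1) (profile_zero c).
Proof.
intros Hc.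
assert (Hic := Rinv_0_lt_compat c Hc).
assert (Hn : forall x, w_num 0 (/ c) x = x ^ 2 - (1 / c - 1)) by (intros; unfold w_num; field; lra).
assert (Hdn : forall x, w_den 0 (/ c) x = / c) by (intros; unfold w_den; field; lra).
assert (Ha : forall x, x ^ 2 > 1 / c - 1 -> admissible 0 (/ c) x).
{ intros x Dx; split; [now rewrite Hdn|left; rewrite Hn; lra]. }
assert (Hw : forall x, sqrt (c * x ^ 2 + c - 1) = w 0 (/ c) x).
{ intros x; unfold w; f_equal; field; lra. }
split; auto.
- apply (open_ext (fun x => 0 < 1 * x ^ 2 + - (1 / c - 1))); [intros; split; lra|].
  apply open_quadratic.
- intros s C x _ Dx.
  apply (is_derive_ext (fun x => 1 / 2 * (s * w 0 (/ c) x - s * atan (w 0 (/ c) x) + atan x) + C)).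
  { intros y; unfold profile_zero; now rewrite Hw. }
  assert (Hwd := is_derive_w _ _ _ (Ha x Dx)).
  assert (Hwp : 0 < w 0 (/ c) x).
  { apply w_gt0; [now rewrite Hdn|rewrite Hn; lra]. }
  rewrite (w_deriv_w _ _ _ _ (Ha x Dx) eq_refl) in Hwd by lra.
  assert (Hx := sqr_pos x); assert (H1 := sqr_pos (w 0 (/ c) x)).
  auto_derive.
  + repeat split; eexists; exact Hwd.
  + replace (Derive (fun x => w 0 (/ c) x) x) with
      (x * (1 + w 0 (/ c) x ^ 2) * (1 + 0 / 4 * (1 + w 0 (/ c) x ^ 2))
       / ((1 + x ^ 2) * w 0 (/ c) x)) by now symmetry; apply is_derive_unique.
    unfold slope, Rsqr; field; lra.
- intros s C d _; exists (C + d); intros x; unfold profile_zero; ring.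
Qed.

(** For [k = -4] the numerator of [w^2] is the constant [1 - c], and the
    argument of the arc tangent in [profile_m4] is [1 / w]. *)
Lemma m4_family (c : R) (Dom : R -> Prop) :
  c < 1 -> (forall x, Dom x <-> 0 < x ^ 2 + c) ->
  solution_family (-4) c Dom (profile_m4 c).
Proof.
intros Hc HDom.
assert (Hn : forall x, w_num (-4) c x = 1 - c) by (intros; unfold w_num; field).
assert (Hdn : forall x, w_den (-4) c x = x ^ 2 + c) by (intros; unfold w_den; field).
assert (Ha : forall x, Dom x -> admissible (-4) c x).
{ intros x Dx; split; [rewrite Hdn; now apply HDom|left; rewrite Hn; lra]. }
split; auto.
- apply (open_ext (fun x => 0 < 1 * x ^ 2 + c)).
  { intros x; rewrite HDom; split; lra. }
  apply open_quadratic.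
- intros s C x _ Dx.
  assert (Ho : locally x (fun y => 0 < x ^ 2 + c -> 0 < y ^ 2 + c)).
  { assert (H0 : 0 < 1 * x ^ 2 + c) by (apply HDom in Dx; lra).
    generalize (open_quadratic 1 c x H0); apply filter_imp; intros; lra. }
  apply (is_derive_ext_loc
    (fun x => 1 / 2 * (s * atan (/ w (-4) c x) + atan x) + C)).
  { generalize Ho; apply filter_imp; intros y Hy; unfold profile_m4, w.
    rewrite <- sqrt_inv; do 6 f_equal.
    apply HDom in Dx; specialize (Hy Dx); field; lra. }
  assert (Hwd := is_derive_w _ _ _ (Ha x Dx)).
  assert (Hwp : 0 < w (-4) c x).
  { apply w_gt0; [rewrite Hdn; now apply HDom|rewrite Hn; lra]. }
  rewrite (w_deriv_w _ _ _ _ (Ha x Dx) eq_refl) in Hwd by lra.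
  assert (Hx := sqr_pos x); assert (H1 := sqr_pos (w (-4) c x)).
  auto_derive.
  + repeat split; [eexists; exact Hwd|lra].
  + replace (Derive (fun x => w (-4) c x) x) with
      (x * (1 + w (-4) c x ^ 2) * (1 + -4 / 4 * (1 + w (-4) c x ^ 2))
       / ((1 + x ^ 2) * w (-4) c x)) by now symmetry; apply is_derive_unique.
    unfold slope, Rsqr; field; repeat split; nra.
- intros s C d _; exists (C + d); intros x; unfold profile_m4; ring.
Qed.

Lemma atan_family : solution_family (-4) 1 (fun _ => True) profile_atan.
Proof.
split.
- apply open_true.
- intros x _; split; [unfold w_den|now right].
  assert (H := sqr_pos x); lra.
- intros s C x _ _; unfold slope; rewrite w_degenerate; unfold profile_atan.
  auto_derive; [auto|unfold Rsqr; assert (H := sqr_pos x); field; lra].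
- intros s C d _; exists (C + d); intros x; unfold profile_atan; ring.
Qed.

(** In particular [c1 + w^2] vanishes only if [c = - k / 4]. *)
Lemma c1_bound (k c x : R) :
  k <> 0 -> admissible k c x -> (Defs.c1 k + w k c x ^ 2) * (k * w_den k c x) = 4 * c + k.
Proof.
intros Hk Ha; rewrite (w_sqr k c x Ha); unfold Defs.c1.
destruct Ha as [Hd _]; unfold w_num, w_den in *; field; lra.
Qed.

(** For generic [k] and [c], integration by the substitution [w] gives
    [dw (- 1 / (1 + w^2) + c1 / (c1 + w^2)) / 2] as integrand, since
    [c1 - 1 = 4 / k].  The antiderivative [H] of the second term is an arc tangent
    or a logarithm according to the sign of [c1]. *)
Lemma generic_family (k c : R) (H : R -> R) (F : R -> R -> R -> R) :
  k <> 0 -> k <> -4 -> c <> - k / 4 ->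
  (forall x, 0 < w k c x -> Defs.c1 k + w k c x ^ 2 <> 0 ->
     is_derive H (w k c x) (Defs.c1 k / (2 * (Defs.c1 k + w k c x ^ 2)))) ->
  (forall s C x, F s C x
     = 1 / 2 * atan x - s * (1 / 2 * atan (w k c x)) + s * (H (w k c x) + C)) ->
  solution_family k c (dom_w k c) F.
Proof.
intros Hk Hk4 Hc HH HF.
assert (Hdom : forall x, dom_w k c x -> 0 < w_den k c x /\ 0 < w_num k c x).
{ intros x [Hd Hn]; unfold w_den, w_num; split; lra. }
assert (Ha : forall x, dom_w k c x -> admissible k c x).
{ intros x Dx; destruct (Hdom x Dx); split; auto. }
split; auto.
- unfold dom_w; apply open_and.
  + apply (open_ext (fun x => 0 < - (k / 4) * x ^ 2 + c)); [intros; split; lra|].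
    apply open_quadratic.
  + apply (open_ext (fun x => 0 < (1 + k / 4) * x ^ 2 + (1 - c))); [intros; split; lra|].
    apply open_quadratic.
- intros s C x _ Dx.
  destruct (Hdom x Dx) as [Hd Hn].
  assert (Hwp := w_gt0 k c x Hd Hn).
  assert (Hwd := is_derive_w _ _ _ (Ha x Dx)).
  rewrite (w_deriv_w _ _ _ _ (Ha x Dx) eq_refl) in Hwd by lra.
  assert (Hb := c1_bound k c x Hk (Ha x Dx)).
  assert (Hx := sqr_pos x); assert (H1 := sqr_pos (w k c x)).
  assert (Hnz : Defs.c1 k + w k c x ^ 2 <> 0).
  { intros H0; rewrite H0 in Hb; apply Hc; lra. }
  assert (HHd := HH x Hwp Hnz).
  apply (is_derive_ext (fun x =>
    1 / 2 * atan x - s * (1 / 2 * atan (w k c x)) + s * (H (w k c x) + C))).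
  { intros y; now rewrite HF. }
  auto_derive.
  + repeat split; eexists; eassumption.
  + replace (Derive (fun x => w k c x) x) with
      (x * (1 + w k c x ^ 2) * (1 + k / 4 * (1 + w k c x ^ 2))
       / ((1 + x ^ 2) * w k c x)) by now symmetry; apply is_derive_unique.
    replace (Derive (fun x => H x) (w k c x)) with (Defs.c1 k / (2 * (Defs.c1 k + w k c x ^ 2)))
      by now symmetry; apply is_derive_unique.
    unfold slope, Rsqr; unfold Defs.c1 in *; field; repeat split; try lra.
    intros H0; apply Hnz; field_simplify_eq; lra.
- intros s C d Hs; exists (C + s * d); intros x; rewrite !HF.
  assert (Hss := sign_sqr s Hs).
  replace (s * (H (w k c x) + (C + s * d))) with (s * (H (w k c x) + C) + s * s * d) by ring.
  rewrite Hss; ring.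
Qed.

Lemma pos_family (k c : R) :
  k <> 0 -> Defs.c1 k > 0 -> c <> - k / 4 ->
  solution_family k c (dom_w k c) (profile_pos k c).
Proof.
intros Hk Hc1 Hc.
assert (Hr := sqrt_lt_R0 _ Hc1); assert (Hr2 := sqrt_sqrt _ (Rlt_le _ _ Hc1)).
apply generic_family with (fun v => sqrt (Defs.c1 k) / 2 * atan (v / sqrt (Defs.c1 k))); auto.
- intros ->; unfold Defs.c1 in Hc1; lra.
- intros x Hw _; auto_derive; [auto|].
  set (r := sqrt (Defs.c1 k)) in *; rewrite <- Hr2; unfold Rsqr; field; split; nra.
Qed.

Lemma is_derive_ln_Rabs (y : R) : y <> 0 -> is_derive (fun y => ln (Rabs y)) y (/ y).
Proof.
intros Hy; destruct (Rdichotomy _ _ Hy) as [Hn|Hp].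
- apply (is_derive_ext_loc (fun y => ln (- y))).
  + generalize (open_lt 0 y Hn); apply filter_imp; intros z Hz.
    now rewrite Rabs_left.
  + auto_derive; [lra|field; lra].
- apply (is_derive_ext_loc ln).
  + generalize (open_gt 0 y Hp); apply filter_imp; intros z Hz.
    rewrite Rabs_pos_eq; lra.
  + auto_derive; [lra|field; lra].
Qed.

Lemma neg_family (k c : R) :
  k <> 0 -> Defs.c1 k < 0 -> c <> - k / 4 ->
  solution_family k c (dom_w k c) (profile_neg k c).
Proof.
intros Hk Hc1 Hc.
assert (Hc1' : 0 < - Defs.c1 k) by lra.
assert (Hr := sqrt_lt_R0 _ Hc1'); assert (Hr2 := sqrt_sqrt _ (Rlt_le _ _ Hc1')).
apply generic_family with (fun v => Defs.c1 k / (4 * sqrt (- Defs.c1 k))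
         * ln (Rabs ((v - sqrt (- Defs.c1 k)) / (v + sqrt (- Defs.c1 k))))); auto.
- intros ->; unfold Defs.c1 in Hc1; lra.
- intros x Hw Hnz.
  set (r := sqrt (- Defs.c1 k)) in *; set (W := w k c x) in *.
  assert (HWr : W - r <> 0) by (intros H0; apply Hnz; nra).
  assert (Hq : (W - r) / (W + r) <> 0).
  { apply Rmult_integral_contrapositive_currified; [auto|apply Rinv_neq_0_compat; lra]. }
  assert (Hqd : is_derive (fun v => (v - r) / (v + r)) W (2 * r / (W + r) ^ 2)).
  { auto_derive; [lra|field; lra]. }
  assert (Hl := is_derive_comp (fun y => ln (Rabs y)) (fun v => (v - r) / (v + r)) W
                  _ _ (is_derive_ln_Rabs _ Hq) Hqd).
  evar_last; [exact (is_derive_scal _ _ (Defs.c1 k / (4 * r)) _ Hl)|].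
  unfold scal; simpl; unfold mult; simpl.
  replace (Defs.c1 k) with (- (r * r)) by lra.
  field; repeat split; nra.
Qed.

(** For [c = - k / 4] both [w_num] and [w_den] are multiples of [1 + x^2], and
    [w = sqrt (- c1)] is constant. *)
Lemma log_family (k : R) :
  k <> 0 -> Defs.c1 k <= 0 ->
  solution_family k (- k / 4) (fun x => x <> 0) (profile_log k).
Proof.
intros Hk Hc1.
assert (Hk4 : -4 <= k < 0).
{ assert (Hkc : k * Defs.c1 k = k + 4) by (unfold Defs.c1; field; auto).
  destruct (Rdichotomy _ _ Hk); split; nra. }
assert (Hdn : forall x, w_den k (- k / 4) x = - k / 4 * (1 + x ^ 2))
  by (intros; unfold w_den; field).
assert (Hn : forall x, w_num k (- k / 4) x = (k + 4) / 4 * (1 + x ^ 2))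
  by (intros; unfold w_num; field).
assert (Hw : forall x, w k (- k / 4) x = sqrt (- Defs.c1 k)).
{ intros x; unfold w; fold (w_num k (- k / 4) x) (w_den k (- k / 4) x).
  rewrite Hn, Hdn; f_equal; assert (Hx := sqr_pos x).
  unfold Defs.c1; field; lra. }
split.
- apply open_neq.
- intros x _; assert (Hx := sqr_pos x).
  split; [rewrite Hdn; nra|].
  destruct (Req_dec k (-4)) as [->|]; [right; split; lra|left; rewrite Hn; nra].
- intros s C x _ _; assert (Hx := sqr_pos x).
  unfold slope; rewrite Hw; unfold profile_log.
  auto_derive; [lra|unfold Rsqr; field; lra].
- intros s C d _; exists (C + d); intros x; unfold profile_log; ring.
Qed.

Lemma profile_family_solution (k : R) (Dom : R -> Prop) (F : R -> R -> R -> R) :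
  profile_family k Dom F -> exists c, solution_family k c Dom F.
Proof.
intros [c -> Hc | c -> Hc | -> | c -> Hc | c Hk Hc1 Hc | c Hk Hc1 Hc | Hk Hc1].
- exists (/ c); now apply zero_family.
- exists c; apply m4_family; [lra|].
  intros x; assert (Hx := pow2_ge_0 x); split; [lra|auto].
- exists 1; apply atan_family.
- exists c; apply m4_family; [lra|]; intros x; split; lra.
- exists c; now apply pos_family.
- exists c; now apply neg_family.
- exists (- k / 4); now apply log_family.
Qed.

(** Every constant [c] of the first integral that occurs at a point is covered by
    one of the families, and the domain of that family misses no point where
    [w] makes sense, except possibly [0]. *)
Lemma admissible_family (k c x1 : R) :
  x1 <> 0 -> admissible k c x1 ->
  exists (Dom : R -> Prop) (F : R -> R -> R -> R),
    profile_family k Dom F /\ solution_family k c Dom F /\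
    (forall x, x <> 0 -> admissible k c x -> Dom x).
Proof.
intros Hx1 [Hd Hn].
destruct (Req_dec k 0) as [->|Hk].
{ assert (Hc : 0 < c) by (unfold w_den in Hd; lra).
  exists (fun x => x ^ 2 > 1 / (/ c) - 1), (profile_zero (/ c)).
  assert (Hic := Rinv_0_lt_compat c Hc).
  assert (Hz := zero_family (/ c) Hic); rewrite Rinv_inv in Hz.
  split; [now constructor|split; [exact Hz|]].
  intros x _ [_ [Hx|[H0 _]]]; [|lra].
  unfold w_num in Hx; unfold Rdiv; rewrite Rinv_inv; lra. }
destruct (Req_dec k (-4)) as [->|Hk4].
{ destruct (Req_dec c 1) as [->|Hc1].
  - exists (fun _ => True), profile_atan.
    split; [now constructor|split; [apply atan_family|auto]].
  - assert (Hc : c < 1).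
    { destruct Hn as [Hn|[_ H1]]; [unfold w_num in Hn; lra|contradiction]. }
    destruct (Rlt_le_dec 0 c) as [H0|H0].
    + exists (fun _ => True), (profile_m4 c).
      split; [now constructor|split; [apply m4_family; [lra|]|auto]].
      intros x; assert (Hx := pow2_ge_0 x); split; [lra|auto].
    + exists (fun x => x ^ 2 > - c), (profile_m4 c).
      split; [now constructor|split; [apply m4_family; [lra|]|]].
      * intros x; split; lra.
      * intros x _ [Hx _]; unfold w_den in Hx; lra. }
assert (Hc1 : Defs.c1 k <> 0).
{ unfold Defs.c1; apply Rmult_integral_contrapositive_currified;
    [lra|now apply Rinv_neq_0_compat]. }
assert (Hdom : forall x, admissible k c x -> dom_w k c x).
{ intros x [Hx [Hy|[H4 _]]]; [|contradiction].
  unfold w_den, w_num in *; split; lra. }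
destruct (Req_dec c (- k / 4)) as [->|Hc].
- exists (fun x => x <> 0), (profile_log k).
  assert (Hneg : Defs.c1 k <= 0).
  { destruct Hn as [Hn|[H4 _]]; [|contradiction].
    assert (Hx := sqr_pos x1).
    assert (Hkc : k * Defs.c1 k = k + 4) by (unfold Defs.c1; field; auto).
    assert (Hk1 : 0 < - k * (1 + x1 ^ 2)) by (unfold w_den in Hd; lra).
    assert (Hk2 : 0 < (k + 4) * (1 + x1 ^ 2)) by (unfold w_num in Hn; lra).
    assert (k < 0) by nra; assert (0 < k + 4) by nra; nra. }
  split; [now constructor|split; [now apply log_family|auto]].
- destruct (Rdichotomy _ _ Hc1) as [Hneg|Hpos].
  + exists (dom_w k c), (profile_neg k c).
    split; [now constructor|split; [now apply neg_family|auto]].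
  + exists (dom_w k c), (profile_pos k c).
    split; [now constructor|split; [now apply pos_family|auto]].
Qed.

(** * Functions on a convex subset of the line *)

Definition convex_set (D : R -> Prop) : Prop :=
  forall x y z, D x -> D z -> x <= y <= z -> D y.

Lemma convex_oitv (lo hi : Rbar) : convex_set (oitv lo hi).
Proof.
intros x y z [Hx _] [_ Hz] [Hxy Hyz]; split.
- apply Rbar_lt_le_trans with x; [exact Hx|exact Hxy].
- apply Rbar_le_lt_trans with z; [exact Hyz|exact Hz].
Qed.

Lemma open_oitv (lo hi : Rbar) : open (oitv lo hi).
Proof.
intros x [Hlo Hhi].
generalize (filter_and _ _ (open_Rbar_gt' x lo Hlo) (open_Rbar_lt' x hi Hhi)).
apply filter_imp; intros y [Hy1 Hy2]; now split.
Qed.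

(** The mean value theorem tolerates the missing derivative at [0], once the
    interval is cut there. *)
Lemma constant_off_zero (D : R -> Prop) (Q : R -> R) :
  convex_set D -> (forall x, D x -> continuous Q x) ->
  (forall x, D x -> x <> 0 -> is_derive Q x 0) ->
  forall x y, D x -> D y -> Q x = Q y.
Proof.
intros HD HC HQ.
assert (Hlt : forall x y, D x -> D y -> x < y -> ~ (x < 0 < y) -> Q x = Q y).
{ intros x y Dx Dy Hxy H0.
  destruct (MVT_gen Q x y (fun _ => 0)) as [z [_ Hz]].
  - rewrite Rmin_left, Rmax_right by lra; intros z Hz; apply HQ.
    + apply HD with x y; auto; lra.
    + intros ->; auto.
  - rewrite Rmin_left, Rmax_right by lra; intros z Hz.
    apply continuity_pt_filterlim, HC, HD with x y; auto.
  - lra. }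
assert (Hle : forall x y, D x -> D y -> x < y -> Q x = Q y).
{ intros x y Dx Dy Hxy.
  destruct (Rlt_dec x 0) as [Hx|Hx]; [|apply Hlt; auto; lra].
  destruct (Rlt_dec 0 y) as [Hy|Hy]; [|apply Hlt; auto; lra].
  assert (D0 : D 0) by (apply HD with x y; auto; lra).
  transitivity (Q 0); apply Hlt; auto; lra. }
intros x y Dx Dy; destruct (Rtotal_order x y) as [H|[->|H]]; auto.
symmetry; auto.
Qed.

Lemma constant_sign (D : R -> Prop) (H : R -> R) :
  convex_set D -> (forall x, D x -> continuous H x) -> (forall x, D x -> H x <> 0) ->
  exists s, is_sign s /\ forall x, D x -> 0 < s * H x.
Proof.
intros HD HC H0.
assert (Hlt : forall h : R -> R, (forall x, D x -> continuous h x) ->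
  (forall x, D x -> h x <> 0) -> forall x y, D x -> D y -> x < y -> h x < 0 -> h y < 0).
{ intros h hC h0 x y Dx Dy Hxy Hx.
  destruct (Rdichotomy _ _ (h0 y Dy)) as [|Hy]; [assumption|exfalso].
  destruct (Ranalysis5.IVT_interv h x y) as [z [Hz Hz0]]; auto.
  - intros z Hz; apply continuity_pt_filterlim, hC, HD with x y; auto.
  - apply (h0 z); [apply HD with x y|]; auto. }
assert (HCo : forall x, D x -> continuous (fun x => - H x) x)
  by (intros x Dx; apply (continuous_opp (V := R_NormedModule)), HC, Dx).
assert (H0o : forall x, D x -> - H x <> 0)
  by (intros x Dx; apply Ropp_neq_0_compat; auto).
destruct (Classical_Prop.classic (exists x, D x /\ 0 < H x)) as [[x0 [Dx0 Hp]]|Hnp].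
- exists 1; split; [now left|]; intros x Dx.
  rewrite Rmult_1_l; destruct (Rdichotomy _ _ (H0 x Dx)) as [Hn|]; [exfalso|lra].
  destruct (Rtotal_order x x0) as [Hx|[->|Hx]].
  + assert (H1 := Hlt H HC H0 x x0 Dx Dx0 Hx Hn); lra.
  + lra.
  + assert (H1 := Hlt _ HCo H0o x0 x Dx0 Dx Hx); simpl in H1; lra.
- exists (-1); split; [now right|]; intros x Dx.
  destruct (Rdichotomy _ _ (H0 x Dx)) as [Hn|Hp]; [lra|].
  exfalso; apply Hnp; now exists x.
Qed.

(** * The first integral of the curvature equation *)

(** The continuous extension of [G x / x] to [0], for [G 0 = 0]. *)
Definition quotient (G : R -> R) (x : R) : R :=
  if Req_dec_T x 0 then Derive G 0 else G x / x.

Lemma quotient_off_zero (G : R -> R) (x : R) : x <> 0 -> quotient G x = G x / x.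
Proof. intros Hx; unfold quotient; destruct (Req_dec_T x 0); [contradiction|reflexivity]. Qed.

Lemma continuous_quotient (G : R -> R) (x : R) :
  ex_derive G x -> (x = 0 -> G 0 = 0) -> continuous (quotient G) x.
Proof.
intros HG HG0; destruct (Req_dec x 0) as [->|Hx].
- specialize (HG0 eq_refl).
  apply Derive_correct in HG; apply is_derive_Reals in HG.
  apply filterlim_locally; intros eps.
  destruct (HG eps (cond_pos eps)) as [delta Hd].
  exists delta; intros y Hy.
  change (Rabs (quotient G y - quotient G 0) < eps).
  assert (E0 : quotient G 0 = Derive G 0)
    by (unfold quotient; destruct (Req_dec_T 0 0); [reflexivity|lra]).
  destruct (Req_dec y 0) as [->|Hy0].
  + rewrite Rminus_diag, Rabs_R0; apply cond_pos.
  + rewrite E0, quotient_off_zero by exact Hy0.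
    assert (Hb : Rabs y < delta) by (change (Rabs (y - 0) < delta) in Hy; now rewrite Rminus_0_r in Hy).
    generalize (Hd y Hy0 Hb); rewrite Rplus_0_l, HG0, Rminus_0_r; auto.
- apply continuous_ext_loc with (fun y => G y / y).
  + generalize (open_neq 0 x Hx); apply filter_imp; intros y Hy.
    symmetry; now apply quotient_off_zero.
  + apply (ex_derive_continuous (fun y => G y / y)); auto_derive; auto.
Qed.

(** [H] is [G x / x] for [G = 2 (1 + x^2) f' - 1], extended to [0].  If [0] lies in [D] and
    [G 0 <> 0], the constant is [c = 0]; then [w_den] vanishes at [0] and nothing is
    claimed there. *)
Lemma first_integral (D : R -> Prop) (f : R -> R) (k x0 : R) :
  open D -> convex_set D -> C2_on D f -> constant_curvature D f k -> D x0 ->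
  exists (c : R) (H : R -> R), forall x, D x ->
    (x <> 0 -> 0 < w_den k c x) /\
    (0 < w_den k c x -> continuous H x /\ H x ^ 2 * w_den k c x = w_num k c x /\
       Derive f x = (1 + x * H x) / (2 * (1 + x ^ 2))).
Proof.
intros HDo HDc Hf HK Dx0.
set (G := fun x => 2 * (1 + x ^ 2) * Derive f x - 1).
assert (HGf : forall x, Derive f x = (1 + G x) / (2 * (1 + x ^ 2))).
{ intros x; assert (Hx := sqr_pos x); unfold G; field; lra. }
assert (HN : forall x, norm2 f x = (G x ^ 2 + x ^ 2) / (1 + x ^ 2)).
{ intros x; assert (Hx := sqr_pos x); unfold norm2, G; field; lra. }
assert (HGd : forall x, D x -> ex_derive G x).
{ intros x Dx; destruct (Hf x Dx) as [_ [Hg _]]; unfold G; auto_derive; auto. }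
assert (HNpos : forall x, (x <> 0 \/ G x <> 0) -> 0 < norm2 f x).
{ intros x Hx; rewrite HN; apply Rdiv_lt_0_compat; [|apply sqr_pos].
  assert (H1 := pow2_ge_0 x); assert (H2 := pow2_ge_0 (G x)).
  destruct Hx as [Hx|Hx]; apply pow2_gt_0 in Hx; lra. }
assert (HNd : forall x, D x -> ex_derive (norm2 f) x).
{ intros x Dx; destruct (Hf x Dx) as [_ [Hg _]]; unfold norm2; auto_derive; auto. }
set (P := fun x => x ^ 2 / norm2 f x + k / 4 * x ^ 2).
assert (HPd : forall x, D x -> x <> 0 -> is_derive P x 0).
{ intros x Dx Hx.
  assert (HNx := HNpos x (or_introl Hx)).
  assert (Hd := Derive_correct _ _ (HNd x Dx)).
  set (d := Derive (norm2 f) x) in *.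
  assert (E : 2 * x * d / norm2 f x ^ 2 - 4 / norm2 f x = k).
  { assert (Ex : x / 1 = x) by field.
    assert (Hex : locally x (ex_derive f)).
    { generalize (HDo x Dx); apply filter_imp; intros y Dy; now apply Hf. }
    rewrite <- (HK (f x) 1 x); try rewrite Ex; auto; try lra.
    - assert (HG1 := horizontal_gauss_revolution f (f x) 1 x d); rewrite Ex in HG1.
      symmetry; apply HG1; auto; lra.
    - unfold revolution; rewrite Ex; ring.
    - unfold noncharacteristic.
      destruct (normH_revolution f (f x) 1 x) as [_ [_ [_ ->]]]; rewrite ?Ex; try lra.
      + now apply Hf.
      + apply Rgt_not_eq, sqrt_lt_R0, HNx. }
  unfold P; auto_derive.
  - split; [now apply HNd|split; [lra|auto]].
  - replace (Derive (fun x => norm2 f x) x) with d by reflexivity.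
    rewrite <- E; field; lra. }
assert (HPc : forall x, D x -> (x <> 0 \/ G x <> 0) -> continuous P x).
{ intros x Dx Hx; apply (ex_derive_continuous P).
  unfold P; auto_derive; split; [now apply HNd|split; [|auto]].
  apply Rgt_not_eq; now apply HNpos. }
(* The conserved quantity [P] is continuous on [D] unless [G 0 = 0]; in that case
   [Q] is its continuous extension. *)
destruct (Classical_Prop.classic (D 0 /\ G 0 = 0)) as [[D0 HG0]|HnG].
- set (Q := fun x => (1 + x ^ 2) / (1 + quotient G x ^ 2) + k / 4 * x ^ 2).
  assert (HG0' : forall x, G x = x * quotient G x).
  { intros x; destruct (Req_dec x 0) as [->|Hx]; [lra|].
    rewrite quotient_off_zero by exact Hx; field; exact Hx. }
  assert (HPQ : forall x, x <> 0 -> P x = Q x).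
  { intros x Hx; unfold P, Q; rewrite HN, HG0'.
    assert (H1 := sqr_pos x); assert (H2 := sqr_pos (quotient G x)).
    assert (H3 := Rmult_lt_0_compat _ _ (pow2_gt_0 x Hx) H2).
    field; repeat split; lra. }
  assert (HQ : forall x, D x -> Q x = Q 0).
  { intros x Dx; apply (constant_off_zero D Q); auto.
    - intros y Dy; unfold Q.
      apply (continuous_plus (V := R_NormedModule)).
      + unfold Rdiv; apply (continuous_mult (K := R_AbsRing)).
        * apply (ex_derive_continuous (fun y => 1 + y ^ 2)); auto_derive; auto.
        * apply (continuous_comp (quotient G) (fun q => / (1 + q ^ 2))).
          -- apply continuous_quotient; auto.
          -- apply (ex_derive_continuous (fun q => / (1 + q ^ 2))); auto_derive.
             assert (Hq := sqr_pos (quotient G y)); simpl in Hq; lra.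
      + apply (ex_derive_continuous (fun y => k / 4 * y ^ 2)); auto_derive; auto.
    - intros y Dy Hy; apply (is_derive_ext_loc P); [|now apply HPd].
      generalize (open_neq 0 y Hy); apply filter_imp; auto. }
  exists (Q 0), (quotient G); intros x Dx.
  assert (H1 := sqr_pos x); assert (H2 := sqr_pos (quotient G x)).
  assert (Hden : w_den k (Q 0) x = (1 + x ^ 2) / (1 + quotient G x ^ 2)).
  { unfold w_den; rewrite <- (HQ x Dx); unfold Q; ring. }
  split; [intros _; rewrite Hden; now apply Rdiv_lt_0_compat|intros _].
  split; [apply continuous_quotient; auto|split].
  + replace (w_num k (Q 0) x) with (1 + x ^ 2 - w_den k (Q 0) x) by (unfold w_num, w_den; field).
    rewrite Hden; field; lra.
  + rewrite HGf; now rewrite (HG0' x) at 1.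
- assert (HxG : forall x, D x -> x <> 0 \/ G x <> 0).
  { intros x Dx; destruct (Req_dec x 0) as [->|]; [right; auto|now left]. }
  assert (HP : forall x, D x -> P x = P x0).
  { intros x Dx; apply (constant_off_zero D P); auto. }
  exists (P x0), (quotient G); intros x Dx.
  assert (HNx := HNpos x (HxG x Dx)).
  assert (Hden : w_den k (P x0) x = x ^ 2 / norm2 f x).
  { unfold w_den; rewrite <- (HP x Dx); unfold P; ring. }
  split.
  + intros Hx; rewrite Hden; apply Rdiv_lt_0_compat; [now apply pow2_gt_0|exact HNx].
  + intros Hd.
    assert (Hx : x <> 0).
    { intros Hx; rewrite Hden, Hx in Hd; unfold Rdiv in Hd; lra. }
    assert (H1 := sqr_pos x).
    split; [apply continuous_quotient; auto; contradiction|split].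
    * replace (w_num k (P x0) x) with (1 + x ^ 2 - w_den k (P x0) x) by (unfold w_num, w_den; field).
      assert (Hp := pow2_gt_0 x Hx); assert (Hg := pow2_ge_0 (G x)).
      rewrite Hden, quotient_off_zero, HN by exact Hx; field; lra.
    * rewrite HGf, quotient_off_zero by exact Hx.
      replace (x * (G x / x)) with (G x) by (field; exact Hx); reflexivity.
Qed.

(** * Classification *)

(** A zero [x <> 0] would be a local minimum of [w_num], a polynomial
    [p x^2 + q]; as [x <> 0] this forces [p = 0], and then [q = 0]. *)
Lemma w_num_positive_or_degenerate (D : R -> Prop) (k c : R) :
  open D -> (forall x, D x -> x <> 0 -> 0 <= w_num k c x) ->
  (k = -4 /\ c = 1) \/ (forall x, D x -> x <> 0 -> 0 < w_num k c x).
Proof.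
intros HD Hn.
destruct (Classical_Prop.classic (k = -4 /\ c = 1)) as [Hdeg|Hdeg]; [now left|right].
intros x Dx Hx; destruct (Hn x Dx Hx) as [|Hz]; [assumption|exfalso; apply Hdeg].
assert (Hx2 := pow2_gt_0 x Hx).
destruct (HD x Dx) as [eps Heps].
(* Compare the values of [w_num] at [x + m] and [x - m] with the one at [x]. *)
assert (Hm : exists m, 0 < m < eps /\ m < Rabs x).
{ assert (He := cond_pos eps); assert (Hax := Rabs_pos_lt x Hx).
  exists (Rmin eps (Rabs x) / 2).
  assert (H0 := Rmin_glb_lt _ _ _ He Hax).
  assert (H1 := Rmin_l eps (Rabs x)); assert (H2 := Rmin_r eps (Rabs x)); lra. }
destruct Hm as [m [Hm Hmx]].
assert (Hnear : forall y, Rabs (y - x) = m -> 0 <= w_num k c y).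
{ intros y Hy; apply Hn.
  - apply Heps; change (Rabs (y - x) < eps); lra.
  - intros ->; rewrite Rminus_0_l, Rabs_Ropp in Hy; lra. }
assert (Hp : 0 <= w_num k c (x + m)).
{ apply Hnear; replace (x + m - x) with m by ring; apply Rabs_pos_eq; lra. }
assert (Hq : 0 <= w_num k c (x - m)).
{ apply Hnear; replace (x - m - x) with (- m) by ring.
  rewrite Rabs_Ropp; apply Rabs_pos_eq; lra. }
assert (Hx0 : m < x \/ m < - x)
  by (unfold Rabs in Hmx; destruct (Rcase_abs x); auto).
assert (Hk : 1 + k / 4 = 0).
{ assert (Ep : w_num k c (x + m) - w_num k c x = (1 + k / 4) * (m * (2 * x + m)))
    by (unfold w_num; ring).
  assert (Eq : w_num k c (x - m) - w_num k c x = (1 + k / 4) * (m * (m - 2 * x)))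
    by (unfold w_num; ring).
  rewrite <- Hz in Ep, Eq.
  assert (Hpp : 0 <= (1 + k / 4) * (m * (2 * x + m))) by lra.
  assert (Hqq : 0 <= (1 + k / 4) * (m * (m - 2 * x))) by lra.
  assert (Hsplit : forall p q r : R, 0 < p -> q < 0 -> 0 <= r * p -> 0 <= r * q -> r = 0).
  { intros p q r H0 H1 H2 H3; destruct (Rtotal_order r 0) as [H4|[H4|H4]]; nra. }
  destruct Hx0 as [Hx0|Hx0].
  - apply (Hsplit (m * (2 * x + m)) (m * (m - 2 * x))); try assumption; nra.
  - apply (Hsplit (m * (m - 2 * x)) (m * (2 * x + m))); try assumption; nra. }
unfold w_num in Hz; rewrite Hk in Hz; split; lra.
Qed.

Lemma open_nonzero (D : R -> Prop) (x : R) : open D -> D x -> exists y, D y /\ y <> 0.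
Proof.
intros HD Dx; destruct (Req_dec x 0) as [->|Hx]; [|now exists x].
destruct (HD 0 Dx) as [eps Heps]; assert (He := cond_pos eps).
exists (eps / 2); split; [|lra].
apply Heps; change (Rabs (eps / 2 - 0) < eps).
rewrite Rminus_0_r, Rabs_pos_eq; lra.
Qed.

(** [H^2 = w^2], and a continuous nonvanishing function on an interval has a
    constant sign. *)
Lemma quotient_is_w (D : R -> Prop) (H : R -> R) (k c : R) :
  convex_set D -> (forall x, D x -> admissible k c x) ->
  (forall x, D x -> continuous H x) ->
  (forall x, D x -> H x ^ 2 * w_den k c x = w_num k c x) ->
  exists s, is_sign s /\ forall x, D x -> H x = s * w k c x.
Proof.
intros HD Ha HC HH.
assert (Hsq : forall x, D x -> H x ^ 2 = w k c x ^ 2).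
{ intros x Dx; rewrite (w_sqr k c x (Ha x Dx)), <- (HH x Dx).
  destruct (Ha x Dx) as [Hd _]; field; lra. }
destruct (Classical_Prop.classic (k = -4 /\ c = 1)) as [[-> ->]|Hdeg].
- exists 1; split; [now left|]; intros x Dx.
  specialize (Hsq x Dx); rewrite w_degenerate in *; nra.
- assert (Hw : forall x, D x -> 0 < w k c x).
  { intros x Dx; destruct (Ha x Dx) as [Hd [Hn|]]; [now apply w_gt0|contradiction]. }
  destruct (constant_sign D H HD HC) as [s [Hs Hp]].
  { intros x Dx H0; specialize (Hsq x Dx); specialize (Hw x Dx); rewrite H0 in Hsq; nra. }
  exists s; split; [exact Hs|]; intros x Dx.
  specialize (Hsq x Dx); specialize (Hw x Dx); specialize (Hp x Dx).
  destruct Hs as [-> | ->]; nra.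
Qed.

Lemma solution_unique (D : R -> Prop) (f g : R -> R) (h : R -> R) :
  convex_set D -> (forall x, D x -> is_derive f x (h x)) ->
  (forall x, D x -> is_derive g x (h x)) ->
  exists d, forall x, D x -> f x = g x + d.
Proof.
intros HD Hf Hg.
destruct (Classical_Prop.classic (exists x, D x)) as [[x0 Dx0]|Hne].
- exists (f x0 - g x0); intros x Dx.
  assert (Hd : forall y, D y -> is_derive (fun y => f y - g y) y 0).
  { intros y Dy; evar_last; [apply (is_derive_minus f g y _ _ (Hf y Dy) (Hg y Dy))|].
    apply Rminus_diag. }
  assert (E : f x - g x = f x0 - g x0); [|lra].
  apply (constant_off_zero D (fun y => f y - g y)); auto.
  intros y Dy; apply (ex_derive_continuous (fun y => f y - g y)); eexists; auto.
- exists 0; intros x Dx; exfalso; apply Hne; now exists x.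
Qed.

Lemma family_complete (k c : R) (D Dom : R -> Prop) (F : R -> R -> R -> R) (f H : R -> R) :
  convex_set D -> solution_family k c Dom F -> (forall x, D x -> Dom x) ->
  (forall x, D x -> ex_derive f x) ->
  (forall x, D x -> continuous H x /\ H x ^ 2 * w_den k c x = w_num k c x /\
       Derive f x = (1 + x * H x) / (2 * (1 + x ^ 2))) ->
  exists s C, is_sign s /\ forall x, D x -> f x = F s C x.
Proof.
intros HD [_ Ha HdF Hsh] HDom Hf HH.
destruct (quotient_is_w D H k c HD) as [s [Hs Hw]].
- auto.
- intros x Dx; now apply HH.
- intros x Dx; now apply HH.
- destruct (solution_unique D f (F s 0) (slope k c s) HD) as [d Hd].
  + intros x Dx; destruct (HH x Dx) as [_ [_ E]].
    replace (slope k c s x) with (Derive f x); [now apply Derive_correct, Hf|].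
    rewrite E, (Hw x Dx); unfold slope; f_equal; ring.
  + intros x Dx; auto.
  + destruct (Hsh s 0 d Hs) as [C HC].
    exists s, C; split; [exact Hs|]; intros x Dx; rewrite (Hd x Dx); auto.
Qed.

(** Over an empty interval any family of the given curvature will do. *)
Lemma admissible_exists (k : R) : exists c x, x <> 0 /\ admissible k c x.
Proof.
exists (1 / 2 + k / 4), 1; split; [lra|]; split; [unfold w_den; lra|left; unfold w_num; lra].
Qed.

Theorem theorem4p20 (k : R) :
  (forall (lo hi : Rbar) (f : R -> R),
     C2_on (oitv lo hi) f ->
     constant_curvature (oitv lo hi) f k ->
     exists (Dom : R -> Prop) (F : R -> R -> R -> R),
       profile_family k Dom F /\ member_on (oitv lo hi) f Dom F)
  /\
  (forall (Dom : R -> Prop) (F : R -> R -> R -> R) (s C : R),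
     profile_family k Dom F -> is_sign s ->
     C2_on Dom (F s C) /\ constant_curvature Dom (F s C) k).
Proof.
split.
- intros lo hi f Hf HK.
  assert (Hcv := convex_oitv lo hi); assert (Hop := open_oitv lo hi).
  destruct (Classical_Prop.classic (exists x, oitv lo hi x)) as [[x0 Ix0]|Hne].
  + destruct (open_nonzero _ x0 Hop Ix0) as [x1 [Ix1 Hx1]].
    destruct (first_integral _ f k x1 Hop Hcv Hf HK Ix1) as [c [H HH]].
    assert (Hn : forall x, oitv lo hi x -> x <> 0 -> 0 <= w_num k c x).
    { intros x Ix Hx; destruct (HH x Ix) as [Hd HH1]; specialize (Hd Hx).
      destruct (HH1 Hd) as [_ [<- _]].
      apply Rmult_le_pos; [apply pow2_ge_0|lra]. }
    assert (Ha : forall x, oitv lo hi x -> x <> 0 -> admissible k c x).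
    { intros x Ix Hx; split; [now apply HH|].
      destruct (w_num_positive_or_degenerate _ k c Hop Hn); auto. }
    destruct (admissible_family k c x1 Hx1 (Ha x1 Ix1 Hx1)) as [Dom [F [HF [HS HD]]]].
    exists Dom, F; split; [exact HF|split].
    * intros x Ix Hx; auto.
    * intros lo' hi' Hsub.
      apply (family_complete k c (oitv lo' hi') Dom F f H); auto.
      -- apply convex_oitv.
      -- intros x Ix; now apply Hsub.
      -- intros x Ix; now apply Hf, Hsub.
      -- intros x Ix; destruct (Hsub x Ix) as [Ix' Dx].
         apply (HH x Ix'), (family_admissible _ _ _ _ HS x Dx).
  + destruct (admissible_exists k) as [c [x1 [Hx1 Ha]]].
    destruct (admissible_family k c x1 Hx1 Ha) as [Dom [F [HF _]]].
    exists Dom, F; split; [exact HF|split].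
    * intros x Ix Hx; exfalso; apply Hne; now exists x.
    * intros lo' hi' Hsub; exists 1, 0; split; [now left|].
      intros x Ix; exfalso; apply Hne; exists x; now apply Hsub.
- intros Dom F s C HF Hs.
  destruct (profile_family_solution k Dom F HF) as [c [Ho Ha Hd _]].
  apply (solution_regular k c s Dom (F s C)); auto.
Qed.
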